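(* Let $(\Omega,\mathcal A,\mu)$ be a $\sigma$-finite measure space and $K\in(0,\mu(\Omega))$. Then $$\partial|\cdot|_K(0)=\overline{\operatorname{conv}}^{*}\big(\{f\in L^\infty(\Omega)\mid |f|=\chi_A,\ A\in\mathcal A,\ \mu(A)\le K\}\big),$$ where $\overline{\operatorname{conv}}^{*}$ denotes the weak-* closed convex hull in $L^\infty(\Omega)=L^1(\Omega)'$.
   Context: The largest-$K$-norm is $|u|_K:=\sup_{A\in\mathcal A:\ \mu(A)\le K}\int_A|u|\,d\mu$ for $u\in L^1(\Omega)$. The convex subdifferential at $0$ is taken in $L^1(\Omega)$, with $L^1(\Omega)'$ identified with $L^\infty(\Omega)$: $\partial|\cdot|_K(0)=\{s\in L^\infty(\Omega)\mid |v|_K\ge\int_\Omega s\,v\,d\mu\ \ \forall v\in L^1(\Omega)\}$. $\chi_A$ is the characteristic function of $A$. *)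

(* Defs.v *)
From HB Require Import structures.
From mathcomp Require Import all_boot all_order all_algebra.
From mathcomp Require Import all_classical all_reals all_analysis.
From mathcomp Require Import measurable_realfun ess_sup_inf.

Set Implicit Arguments.
Unset Strict Implicit.
Unset Printing Implicit Defensive.

Import Order.TTheory GRing.Theory Num.Theory.
Import numFieldNormedType.Exports.

Local Open Scope classical_set_scope.
Local Open Scope ring_scope.

Lemma ae_eq_Lnorm d (T : measurableType d) (R : realType)
    (mu : {measure set T -> \bar R}) (p : \bar R) (f g : T -> R) :
  measurable_fun [set: T] f -> measurable_fun [set: T] g ->
  f = g %[ae mu] -> 'N[mu]_p[EFin \o f]%E = 'N[mu]_p[EFin \o g]%E.
Proof.
have mpow (h : T -> R) r : measurable_fun [set: T] h ->
    measurable_fun [set: T] (fun x => `|(h x)%:E| `^ r)%E.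
  move=> mh; have mnh : measurable_fun [set: T] (fun x => `|(h x)%:E|)%E.
    by apply: measurableT_comp => //; exact/measurable_EFinP.
  exact: (measurableT_comp (@measurable_poweR R r) mnh).
move=> mf mg fg; rewrite unlock /Lnorm; case: p => [r||].
- congr (_ `^ _)%E; apply: ge0_ae_eq_integral => //.
  + exact: mpow.
  + exact: mpow.
  + by move=> x _; exact: poweR_ge0.
  + by move=> x _; exact: poweR_ge0.
  + by apply: filterS fg => x /= fg _; rewrite fg.
- case: ifPn => // _; apply: eq_ess_sup.
  by apply: filterS fg => x /= ->.
- case: ifPn => // _; apply: eq_ess_inf.
  by apply: filterS fg => x /= ->.
Qed.

Section Lspace_pi.
Context d (T : measurableType d) (R : realType).
Variables (mu : {measure set T -> \bar R}) (p : \bar R) (p1 : (1 <= p)%E).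

Lemma measurable_Lspace (f : LspaceType mu p1) :
  measurable_fun [set: T] (f : T -> R).
Proof.
exact: (@measurable_funPT _ _ _ _
  (repr (f : {mfun_ mu, T >-> measurableTypeR R}))).
Qed.

Lemma LspaceP (f : LspaceType mu p1) : (f : T -> R) \in Lfun mu p.
Proof.
rewrite inE; apply/andP; split; rewrite inE; first exact: measurable_Lspace.
exact: Lebesgue_finite.
Qed.

Definition Lspace_repr (f : LspaceType mu p1) : LfunType mu p1 :=
  Lfun_Sub p1 (LspaceP f).

Section pi.
Variable f : LfunType mu p1.

Let g : T -> measurableTypeR R := f.

Let measurable_g : measurable_fun [set: T] g.
Proof. exact: (@measurable_funPT _ _ _ _ f). Qed.

HB.instance Definition _ := isMeasurableFun.Build _ _ _ _ g measurable_g.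

Definition Lspace_pi_mfun : {mfun_ mu, T >-> measurableTypeR R} :=
  \pi_({mfun_ mu, T >-> measurableTypeR R})%qT [the {mfun T >-> _} of g].

Lemma Lspace_pi_mfunE : (Lspace_pi_mfun : T -> R) = f %[ae mu].
Proof.
have /eqmodP/asboolP : repr Lspace_pi_mfun = [the {mfun T >-> _} of g]
    %[mod {mfun_ mu, T >-> measurableTypeR R}]%qT.
  by rewrite reprK.
exact.
Qed.

Let finite_norm_pi : finite_norm mu p Lspace_pi_mfun.
Proof.
rewrite /finite_norm (@ae_eq_Lnorm _ _ _ mu p _ f).
- exact: Lfunction_finite.
- exact: (@measurable_funPT _ _ _ _ (repr Lspace_pi_mfun)).
- exact: (@measurable_funPT _ _ _ _ f).
- exact: Lspace_pi_mfunE.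
Qed.

HB.instance Definition _ :=
  @isFinLebesgue.Build _ _ _ mu p p1 Lspace_pi_mfun finite_norm_pi.

Definition Lspace_pi : LspaceType mu p1 := [the LspaceType mu p1 of Lspace_pi_mfun].

End pi.

Lemma Lspace_piE (f : LfunType mu p1) : (Lspace_pi f : T -> R) = f %[ae mu].
Proof. exact: Lspace_pi_mfunE. Qed.

Lemma Lspace_eqP (f g : LspaceType mu p1) :
  f = g <-> (f : T -> R) = g %[ae mu].
Proof.
split=> [->|]; first exact: ae_eq_refl.
move: f g => [f [[fP]]] [g [[gP]]] /= fg.
have fgE : f = g.
  rewrite -[f]reprK -[g]reprK; apply/eqmodP/asboolP; exact: fg.
move: gP; rewrite -fgE => gP.
by rewrite (Prop_irrelevance fP gP).
Qed.

Lemma Lspace_reprK : cancel Lspace_repr Lspace_pi.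
Proof. by move=> f; apply/Lspace_eqP; exact: Lspace_piE. Qed.

Lemma eq_Lspace_pi (f g : LfunType mu p1) :
  Lspace_pi f = Lspace_pi g <-> (f : T -> R) = g %[ae mu].
Proof.
split=> [/Lspace_eqP fg|fg]; last first.
  apply/Lspace_eqP.
  apply: (ae_eq_trans (Lspace_piE f)); apply: (ae_eq_trans fg).
  exact/ae_eq_sym/Lspace_piE.
apply: ae_eq_trans (Lspace_piE g).
by apply: ae_eq_trans fg; exact/ae_eq_sym/Lspace_piE.
Qed.

End Lspace_pi.

(* The vector space structure on classes of functions modulo equality almost
   everywhere, inherited from the one on LfunType. *)
Section Lspace_lmodType.
Context d (T : measurableType d) (R : realType).
Variables (mu : {measure set T -> \bar R}) (p : \bar R) (p1 : (1 <= p)%E).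

Local Notation L := (LspaceType mu p1).
Implicit Types (f g h : L) (a b : R) (u v : LfunType mu p1).

HB.instance Definition _ := gen_eqMixin L.
HB.instance Definition _ := gen_choiceMixin L.

Definition Lspace_zero : L := Lspace_pi 0.
Definition Lspace_opp f : L := Lspace_pi (- Lspace_repr f).
Definition Lspace_add f g : L := Lspace_pi (Lspace_repr f + Lspace_repr g).
Definition Lspace_scale a f : L := Lspace_pi (a *: Lspace_repr f).

Let pi_opp u : Lspace_opp (Lspace_pi u) = Lspace_pi (- u).
Proof.
apply/eq_Lspace_pi; apply: filterS (Lspace_piE u) => x /= xu ?.
by rewrite -[RHS]/(- u x) -xu.
Qed.

Let pi_add u v : Lspace_add (Lspace_pi u) (Lspace_pi v) = Lspace_pi (u + v).
Proof.
apply/eq_Lspace_pi.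
apply: filterS2 (Lspace_piE u) (Lspace_piE v) => x /= xu xv ?.
by rewrite -[RHS]/(u x + v x) -xu// -xv.
Qed.

Let pi_scale a u : Lspace_scale a (Lspace_pi u) = Lspace_pi (a *: u).
Proof.
apply/eq_Lspace_pi; apply: filterS (Lspace_piE u) => x /= xu ?.
by rewrite -[RHS]/(a *: u x) -xu.
Qed.

Let addA : associative Lspace_add.
Proof.
move=> f g h; rewrite -[f]Lspace_reprK -[g]Lspace_reprK -[h]Lspace_reprK.
by rewrite !pi_add addrA.
Qed.

Let addC : commutative Lspace_add.
Proof. by move=> f g; rewrite /Lspace_add addrC. Qed.

Let add0 : left_id Lspace_zero Lspace_add.
Proof. by move=> f; rewrite -[f]Lspace_reprK pi_add add0r. Qed.

Let addN : left_inverse Lspace_zero Lspace_opp Lspace_add.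
Proof. by move=> f; rewrite -[f]Lspace_reprK pi_opp pi_add addNr. Qed.

HB.instance Definition _ := GRing.isZmodule.Build L addA addC add0 addN.

Let scaleA a b f :
  Lspace_scale a (Lspace_scale b f) = Lspace_scale (a * b) f.
Proof. by rewrite -[f]Lspace_reprK !pi_scale scalerA. Qed.

Let scale1 : left_id 1 Lspace_scale.
Proof. by move=> f; rewrite -[f]Lspace_reprK pi_scale scale1r. Qed.

Let scaleDr : right_distributive Lspace_scale +%R.
Proof.
move=> a f g; rewrite -[f]Lspace_reprK -[g]Lspace_reprK.
by rewrite -![_ + _]/(Lspace_add _ _) !(pi_scale, pi_add) scalerDr.
Qed.

Let scaleDl f : {morph Lspace_scale^~ f : a b / a + b}.
Proof.
move=> a b; rewrite -[f]Lspace_reprK -[X in _ = X]/(Lspace_add _ _).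
by rewrite !(pi_scale, pi_add) scalerDl.
Qed.

HB.instance Definition _ :=
  GRing.Zmodule_isLmodule.Build R L scaleA scale1 scaleDr scaleDl.

Lemma Lspace0E : ((0 : L) : T -> R) = cst 0 %[ae mu].
Proof. exact: Lspace_piE. Qed.

Lemma LspaceNE f : ((- f : L) : T -> R) = (fun x => - f x) %[ae mu].
Proof. exact: Lspace_piE. Qed.

Lemma LspaceDE f g : ((f + g : L) : T -> R) = (fun x => f x + g x) %[ae mu].
Proof. exact: Lspace_piE. Qed.

Lemma LspaceZE a f : ((a *: f : L) : T -> R) = (fun x => a * f x) %[ae mu].
Proof. exact: Lspace_piE. Qed.

End Lspace_lmodType.

Definition convex_hull (R : numDomainType) (E : lmodType R) (A : set E) :
  set E := smallest (@convex_set R E) A.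

Section largestK.
Context d (T : measurableType d) (R : realType).
Variable mu : {measure set T -> \bar R}.

Definition L1 : Type := LspaceType1 mu.
Definition Linfty : Type := LspaceType mu (leey 1).

(* The integrand is integrable for every s and v, so that this real-valued
   integral is never the default value of `fine`. *)
Definition dual_pairing (s : Linfty) (v : L1) : R := \int[mu]_x (s x * v x).

(* sigma(L^oo, L^1), the topology induced by Linfty -> R ^ L1 from the product
   topology *)
Definition weak_star : Type :=
  initial_topology (dual_pairing : Linfty -> {ptws L1 -> R}).

HB.instance Definition _ := Topological.on weak_star.

Definition weak_star_closed_convex_hull (S : set Linfty) : set Linfty :=
  closure (convex_hull S : set weak_star).

(* \bar R-valued only to avoid the default value of real suprema: the supremum
   is at most the L^1 norm of u. *)
Definition largest_norm (K : R) (u : L1) : \bar R :=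
  ereal_sup [set (\int[mu]_(x in A) `|(u x)%:E|)%E | A in
    [set A | measurable A /\ (mu A <= K%:E)%E]].

Definition subdifferential0 (phi : L1 -> \bar R) : set Linfty :=
  [set s | forall v : L1, ((dual_pairing s v)%:E <= phi v)%E].

(* Equality of |f| and \1_A is equality in L^oo, i.e. almost everywhere. *)
Definition signed_indicators (K : R) : set Linfty :=
  [set f | exists2 A, measurable A /\ (mu A <= K%:E)%E &
                      (fun x => `|f x|) = \1_A %[ae mu]].

End largestK.

Arguments weak_star_closed_convex_hull {d T R} mu S.
Arguments largest_norm {d T R} mu K u.
Arguments subdifferential0 {d T R} mu phi.
Arguments signed_indicators {d T R} mu K.

(* Main.v *)
(** A basic weak-* neighbourhood constrains the pairing with finitely many v's
    only, so by separation of convex sets in R^n an s lies in the weak-* closed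
    convex hull of a set S exactly when the pairing of s with each v is at most
    the supremum over f in S of the pairing of f with v. For S the signed
    indicators of sets of measure at most K this supremum is the largest-K-norm
    of v: on A, choose the sign of f equal to that of v. *)
Require Import Defs.
From mathcomp Require Import all_boot all_order all_algebra.
From mathcomp Require Import all_classical all_reals all_analysis.
From mathcomp Require Import measurable_realfun ess_sup_inf ring lra.
Import Order.TTheory GRing.Theory Num.Theory.
Import numFieldNormedType.Exports.
Set Implicit Arguments.
Unset Strict Implicit.
Unset Printing Implicit Defensive.
Local Open Scope classical_set_scope.
Local Open Scope ring_scope.

(** * Convex hulls *)

Section convex_hull.
Context (R : numDomainType) (E : lmodType R).
Implicit Types A B : set E.

Lemma sub_convex_hull A : A `<=` convex_hull A.
Proof. exact: sub_gen_smallest. Qed.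

Lemma convex_hull_sub A B : convex_set (B : set (convex_lmodType E)) ->
  A `<=` B -> convex_hull A `<=` B.
Proof. exact: smallest_sub. Qed.

Lemma convex_convex_hull A :
  convex_set (convex_hull A : set (convex_lmodType E)).
Proof.
move=> x y t; rewrite !inE => xA yA B [cB AB].
by apply/set_mem/cB; apply/mem_set; [exact: xA|exact: yA].
Qed.

(** Convexity with a plain real [t], so that the parameter can be computed rather than bundled as an
    element of the unit interval. *)
Lemma convex_hull_segment A x y (t : R) : 0 <= t -> t <= 1 ->
  convex_hull A x -> convex_hull A y ->
  convex_hull A (t *: x + (1 - t) *: y).
Proof.
move=> t0 t1 Ax Ay; apply/set_mem.
exact: (@convex_convex_hull A x y (Itv01 t0 t1) (mem_set Ax) (mem_set Ay)).
Qed.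
End convex_hull.

(** * Separation with respect to a bilinear pairing *)

Section scalar_pairing.
Context (R : realType) (E F : lmodType R) (b : E -> F -> R).
Hypothesis bl : forall v, scalar (b^~ v).
Hypothesis br : forall x, scalar (b x).

Let b0 x : b x 0 = 0.
Proof. by have := br x 1 0 0; rewrite scale1r addr0; lra. Qed.

Let bN x v : b x (- v) = - b x v.
Proof. by rewrite -[- v]addr0 -scaleN1r br b0; lra. Qed.

Let b_sum x (vs : seq F) (a : F -> R) :
  b x (\sum_(v <- vs) a v *: v) = \sum_(v <- vs) a v * b x v.
Proof.
elim: vs => [|v vs IH]; first by rewrite !big_nil b0.
by rewrite !big_cons br IH.
Qed.

Let b_segment (t : R) x y v :
  b (t *: x + (1 - t) *: y) v = b y v + t * (b x v - b y v).
Proof.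
have b00 : b 0 v = 0 by have := bl v 1 0 0; rewrite scale1r addr0; lra.
(* [bl] only expands the shape [a *: x + y]; adding 0 gives the second scaled vector that shape. *)
rewrite bl -[X in _ * _ + b X v]addr0 bl b00; lra.
Qed.

(** A half-space is convex, so it contains the hull of each of its subsets. *)
Lemma convex_hull_scalar_le (A : set E) v r :
  (forall x, A x -> b x v <= r) -> forall x, convex_hull A x -> b x v <= r.
Proof.
move=> Ar; apply: (@convex_hull_sub _ _ A [set x | b x v <= r]) => // x y t.
rewrite !inE /= => xr yr; rewrite /conv/= b_segment.
have : 0 <= t%:num * (r - b x v) by rewrite mulr_ge0 ?subr_ge0.
have : 0 <= (1 - t%:num) * (r - b y v) by rewrite mulr_ge0 ?subr_ge0.
lra.
Qed.

(* If the hull stayed away from s in R^vs, then, c being an almost nearest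
   point, the functional represented by s - c would separate s from A; moving
   from c towards a point of A that violates the separation gets closer to s. *)
Lemma weak_approximation (A : set E) (s : E) :
  (forall v, exists M, forall x, convex_hull A x -> b x v <= M) ->
  (forall v e, 0 < e -> exists2 x, A x & b s v - e < b x v) ->
  forall (vs : seq F) e, 0 < e ->
  exists2 x, convex_hull A x & forall v, v \in vs -> `|b x v - b s v| < e.
Proof.
move=> Abnd Asup vs e e0.
pose C := convex_hull A.
pose D x := \sum_(v <- vs) (b s v - b x v) ^+ 2.
have [x0 Ax0 _] := Asup 0 1 ltr01.
have D_ge0 x : 0 <= D x by apply: sumr_ge0 => v _; exact: sqr_ge0.
have hasinfD : has_inf (D @` C).
  split; first by exists (D x0), x0 => //; exact: sub_convex_hull.
  by exists 0 => _ [x _ <-].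
(* Each square is at most the sum [D x], so [D x < e ^+ 2] bounds every coordinate by [e]. Otherwise
   [D] has infimum at least [e ^+ 2] on the hull. *)
have [[x Cx Dx]|/forall2NP farD] := pselect (exists2 x, C x & D x < e ^+ 2).
  exists x => // v vvs; rewrite -(@ltr_pXn2r _ 2)// ?nnegrE ?(ltW e0)//.
  apply: le_lt_trans Dx; rewrite real_normK ?num_real// -sqrrN opprB.
  rewrite /D (big_rem v)//= lerDl.
  by apply: sumr_ge0 => w _; exact: sqr_ge0.
have infD_gt0 : 0 < inf (D @` C).
  apply: (@lt_le_trans _ _ (e ^+ 2)); first by rewrite exprn_gt0.
  apply: lb_le_inf; first by case: hasinfD.
  move=> _ [x Cx <-]; rewrite leNgt; apply/negP.
  by have [] := farD x.
set del := inf _ in infD_gt0.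
(* [M] bounds the squared diameter of the hull seen in R^vs. The bounds in [Abnd] are upper ones;
   applied to [- v] they give the lower ones. *)
have [M M0 CM] : exists2 M, 0 < M & forall x y, C x -> C y ->
    \sum_(v <- vs) (b x v - b y v) ^+ 2 <= M.
  clear -Abnd bN; elim: vs => [|v vs [M M0 CM]].
    by exists 1 => // x y _ _; rewrite big_nil ler01.
  have [N1 N1P] := Abnd v; have [N2 N2P] := Abnd (- v).
  exists ((`|N1| + `|N2|) ^+ 2 + M); first by rewrite ltr_wpDl ?sqr_ge0.
  move=> x y Cx Cy; rewrite big_cons lerD ?CM//.
  rewrite -real_normK ?num_real// lerXn2r ?nnegrE ?addr_ge0//.
  have := N1P _ Cx; have := N1P _ Cy; have := N2P _ Cx; have := N2P _ Cy.
  rewrite !bN => ? ? ? ?; rewrite ler_norml.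
  have := ler_norm N1; have := ler_norm N2; lra.
(* With [4 * t * M <= del], a step [t] from [c] gains more than [t * del] at first order, while the
   slack in [D c] and the quadratic term cost at most [2 * t ^+ 2 * M <= t * del / 2]. So [D] falls
   below its infimum [del]. *)
pose t := Num.min 1 (del / (4 * M)).
have M4 : 0 < 4 * M by rewrite mulr_gt0.
have t0 : 0 < t by rewrite lt_min ltr01 divr_gt0.
have t1 : t <= 1 by rewrite ge_min lexx.
have tM : t * (4 * M) <= del by rewrite -ler_pdivlMr// ge_min lexx orbT.
have [|_ [c Cc <-] Dc] := @inf_adherent _ _ (t ^+ 2 * M) _ hasinfD.
  by rewrite mulr_gt0 ?exprn_gt0.
pose a v := b s v - b c v.
have del2 : 0 < del / 2 by rewrite divr_gt0.
(* The functional represented by [s - c] exceeds its value at [c] by [D c >= del] at [s], hence by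
   more than [del / 2] at this [x]. *)
have [x Ax] := Asup (\sum_(v <- vs) a v *: v) (del / 2) del2.
rewrite !b_sum => sx.
have Cx : C x by exact: sub_convex_hull.
have le_del y : C y -> del <= D y.
  by move=> Cy; apply: ge_inf; [case: hasinfD|exists y].
have := le_del _ (convex_hull_segment (ltW t0) t1 Cx Cc).
have -> : D (t *: x + (1 - t) *: c) = D c
    - 2 * t * (\sum_(v <- vs) a v * b x v - \sum_(v <- vs) a v * b c v)
    + t ^+ 2 * \sum_(v <- vs) (b x v - b c v) ^+ 2.
  rewrite -sumrB !mulr_sumr -sumrB -big_split/=; apply: eq_bigr => v _.
  by rewrite b_segment /a; ring.
have Dc_del : \sum_(v <- vs) a v * b s v - \sum_(v <- vs) a v * b c v = D c.
  by rewrite -sumrB; apply: eq_bigr => v _; rewrite /a; ring.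
have := le_del _ Cc; have := CM _ _ Cx Cc.
set Q := \sum_(v <- vs) (b x v - b c v) ^+ 2 => QM delc.
have tQ : t ^+ 2 * Q <= t ^+ 2 * M by rewrite ler_wpM2l ?sqr_ge0.
set X := \sum_(v <- vs) a v * b x v - _ => delt.
have delX : t * (del / 2) < t * X by rewrite ltr_pM2l// /X; lra.
have : t * (t * (4 * M)) <= t * del by rewrite ler_wpM2l ?(ltW t0).
by rewrite expr2 in tQ Dc; lra.
Qed.
End scalar_pairing.

(** * Convergence in initial and pointwise topologies *)

Section initial.
Context (S : choiceType) (T : topologicalType) (f : S -> T).

Lemma cvg_initial (G : set_system S) (s : S) : Filter G ->
  (f @ G --> f s) -> G --> (s : initial_topology f).
Proof.
move=> FG fG A [_ [[B oB <-] Bs BA]].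
apply: filterS BA _.
by apply: fG; exact: open_nbhs_nbhs.
Qed.
End initial.

(** The pointwise topology is the supremum of the initial topologies of the evaluations, so it
    suffices to converge in each. *)
Lemma cvg_ptws (U : Type) (V : topologicalType) (G : set_system (U -> V))
    (f : U -> V) :
  Filter G -> (forall u, g u @[g --> G] --> f u) -> G --> (f : {ptws U -> V}).
Proof.
move=> FG Gf; apply/cvg_sup => u; exact: cvg_initial (Gf u).
Qed.

(** * The pairing between L^oo and L^1 *)

Section largest_norm.
Context d (T : measurableType d) (R : realType).
Variable mu : {measure set T -> \bar R}.
Implicit Types (s : Linfty mu) (v : L1 mu) (K : R).

Lemma L1_integrable v : mu.-integrable setT (EFin \o v).
Proof. exact/Lfun1_integrable/LspaceP. Qed.

Lemma Linfty_bounded s : exists M, {ae mu, forall x, `|s x| <= M}.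
Proof.
have := LspaceP s; rewrite inE => /andP[_]; rewrite inE /= /finite_norm unlock.
case: ifPn => [_ sfin|mu0 _].
  exact: (@ess_supr_bounded _ _ _ mu (Num.norm \o s)).
(* On a null space the norm is 0 by convention and bounds nothing, but there the whole space is an
   admissible exceptional set. *)
exists 0, setT; split => //.
by apply/eqP; rewrite -measure_le0 leNgt.
Qed.

(** The product is dominated almost everywhere by a constant multiple of [|v|]. *)
Lemma integrable_Linfty_L1 s v :
  mu.-integrable setT (EFin \o (fun x => s x * v x)).
Proof.
have [M sM] := Linfty_bounded s.
have ms := measurable_Lspace s; have mv := measurable_Lspace v.
apply/integrableP; split.
  by apply/measurable_EFinP; exact: measurable_funM.
have /integrableP[_] : mu.-integrable setT (fun x => M%:E * (EFin \o v) x)%E.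
  by apply: integrableZl => //; exact: L1_integrable.
apply: le_lt_trans; apply: ae_ge0_le_integral => //.
- apply: measurableT_comp => //.
  by apply/measurable_EFinP; exact: measurable_funM.
- apply: measurableT_comp => //.
  by apply: measurable_funeM; exact/measurable_EFinP.
- apply: filterS sM => x sxM _ /=.
  rewrite lee_fin !normrM ler_wpM2r//; exact: le_trans (ler_norm _).
Qed.

(** Operations on classes are known only almost everywhere; this lets the integrand be replaced by
    an explicit function. *)
Lemma ae_eq_dual_pairing s v (f : T -> R) : measurable_fun setT f ->
  (fun x => s x * v x) = f %[ae mu] -> dual_pairing s v = \int[mu]_x f x.
Proof.
move=> mf svf; congr fine; apply: ae_eq_integral => //.
- apply/measurable_EFinP; apply: measurable_funM; exact: measurable_Lspace.
- exact/measurable_EFinP.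
- by apply: filterS svf => x /= ->.
Qed.

(** Common core of linearity in either argument: only the products under the integral matter. *)
Let dual_pairing_lin a s1 v1 s2 v2 s v :
  (fun x => s x * v x) = (fun x => a * (s1 x * v1 x) + s2 x * v2 x) %[ae mu] ->
  dual_pairing s v = a * dual_pairing s1 v1 + dual_pairing s2 v2.
Proof.
move=> svE; have i1 := integrable_Linfty_L1 s1 v1.
have i2 := integrable_Linfty_L1 s2 v2.
have ai1 : mu.-integrable setT (EFin \o (fun x => a * (s1 x * v1 x))).
  exact: (integrableZl measurableT a i1).
rewrite (ae_eq_dual_pairing _ svE); first by rewrite RintegralD// RintegralZl.
by apply/measurable_EFinP/(measurable_int mu); exact: (integrableD _ ai1 i2).
Qed.

Lemma dual_pairing_scalarl v : scalar (fun s : Linfty mu => dual_pairing s v).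
Proof.
move=> a s s'; apply: dual_pairing_lin.
apply: filterS2 (LspaceDE (a *: s) s') (LspaceZE a s) => x /= -> // -> // _.
by rewrite mulrDl mulrA.
Qed.

Lemma dual_pairing_scalarr s : scalar (fun v : L1 mu => dual_pairing s v).
Proof.
move=> a v v'; apply: dual_pairing_lin.
apply: filterS2 (LspaceDE (a *: v) v') (LspaceZE a v) => x /= -> // -> // _.
by rewrite mulrDr mulrCA.
Qed.

(** * The largest-K-norm as support function of the signed indicators *)

Lemma largest_norm_fin_num K v : 0 <= K -> largest_norm mu K v \is a fin_num.
Proof.
move=> K0; rewrite ge0_fin_numE.
  (* The L^1 norm bounds the supremum from above; below, the empty set, admissible as [0 <= K],
     contributes 0. *)
  have /integrableP[mv] := L1_integrable v.
  apply: le_lt_trans; apply: ge_ereal_sup => _ [A [mA _] <-].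
  by apply: ge0_subset_integral => //; exact: measurableT_comp.
apply: ereal_sup_ubound; exists set0; last by rewrite integral_set0.
by rewrite /= measure0 lee_fin.
Qed.

(** The integral of [s v] is at most that of [|s| |v|], which is the integral of [|v|] over the set
    [A] with [|s| = \1_A]. *)
Lemma signed_indicators_le K s v : signed_indicators mu K s ->
  ((dual_pairing s v)%:E <= largest_norm mu K v)%E.
Proof.
move=> [A [mA muA] sA].
apply: le_trans (ereal_sup_ubound _); last by exists A.
rewrite /dual_pairing /Rintegral fineK; last first.
  exact/integrable_fin_num/integrable_Linfty_L1.
apply: le_trans (lee_abs _) _.
have ms := measurable_Lspace s; have mv := measurable_Lspace v.
apply: le_trans (le_abse_integral _ _ _) _ => //.
  by apply/measurable_EFinP; exact: measurable_funM.
rewrite [leRHS]integral_mkcond; apply: ae_ge0_le_integral => //.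
- apply: measurableT_comp => //.
  by apply/measurable_EFinP; exact: measurable_funM.
- by move=> x _; apply: erestrict_ge0.
- apply/(measurable_restrictT _ mA)/measurable_funTS.
  by apply: measurableT_comp => //; exact/measurable_EFinP.
- apply: filterS sA => x /= /(_ I) sxA _.
  rewrite normrM sxA patchE indicE; by case: ifPn => _; rewrite ?mul1r ?mul0r.
Qed.

Lemma convex_hull_signed_indicators_le K s v : 0 <= K ->
  convex_hull (signed_indicators mu K) s ->
  ((dual_pairing s v)%:E <= largest_norm mu K v)%E.
Proof.
move=> K0; rewrite -(fineK (largest_norm_fin_num v K0)) lee_fin.
apply: convex_hull_scalar_le s; first exact: dual_pairing_scalarl.
move=> s Ss; rewrite -lee_fin (fineK (largest_norm_fin_num v K0)).
exact: signed_indicators_le.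
Qed.

Lemma signed_indicators_exists K (A : set T) v :
  measurable A -> (mu A <= K%:E)%E ->
  exists2 f, signed_indicators mu K f &
    (dual_pairing f v)%:E = (\int[mu]_(x in A) `|(v x)%:E|)%E.
Proof.
move=> mA muA; have mv := measurable_Lspace v.
have mB : measurable (v @^-1` `[0, +oo[).
  by rewrite -[X in measurable X]setTI; exact: mv.
(* The sign of [v] cut off to [A], with value 1 at the zeros of [v] so that [|g|] is 1 on all of
   [A]. *)
pose g x : R := \1_A x * (2 * \1_(v @^-1` `[0, +oo[) x - 1).
have mg : measurable_fun setT g.
  apply: measurable_funM => //; apply: measurable_funB => //.
  exact: measurable_funM.
have ng x : `|g x| = \1_A x.
  rewrite /g normrM !indicE; case: (x \in A); last by rewrite normr0 mul0r.
  rewrite normr1 mul1r; case: (_ \in _) => /=.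
    by rewrite ger0_norm; lra.
  by rewrite ler0_norm; lra.
have gv x : g x * v x = (Num.norm \o v) \_ A x.
  rewrite /g patchE !indicE; case: (x \in A); last by rewrite !mul0r.
  have -> : (x \in v @^-1` `[0, +oo[) = (0 <= v x).
    by apply/idP/idP; rewrite inE /= in_itv /= andbT.
  case: (leP 0 (v x)) => v0 /=.
    by rewrite ger0_norm//; lra.
  by rewrite ltr0_norm//; lra.
have gL : g \in Lfun mu +oo.
  rewrite inE; apply/andP; split; rewrite inE//= /finite_norm unlock.
  case: ifPn => // _; apply: (@le_lt_trans _ _ 1%E); last exact: ltry.
  apply/ess_supP/nearW => x /=; rewrite lee_fin ng indicE.
  by case: (_ \in _) => //=.
exists (Lspace_pi (Lfun_Sub (leey 1) gL)).
  exists A => //.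
  apply: filterS (Lspace_piE (Lfun_Sub (leey 1) gL)) => x /= gE _.
  by rewrite gE//; exact: ng.
have iA : mu.-integrable setT (EFin \o (Num.norm \o v) \_ A).
  rewrite -restrict_EFin; apply/(integrable_mkcond _ mA).
  apply: (integrableS measurableT) => //.
  exact: (integrable_norm (L1_integrable v)).
rewrite (@ae_eq_dual_pairing _ _ ((Num.norm \o v) \_ A)).
- rewrite /Rintegral fineK; last exact: (integrable_fin_num measurableT iA).
  rewrite [RHS]integral_mkcond; apply: eq_integral => x _.
  by rewrite /= !patchE; case: ifP.
- exact/measurable_EFinP/(measurable_int mu)/iA.
- apply: filterS (Lspace_piE (Lfun_Sub (leey 1) gL)) => x /= gE _.
  by rewrite gE//; exact: gv.
Qed.

(** * Basic weak-* neighbourhoods and continuity of the pairing *)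

Definition weak_star_ball s (vs : seq (L1 mu)) (e : R) : set (Linfty mu) :=
  [set s' | forall v, v \in vs -> `|dual_pairing s' v - dual_pairing s v| < e].

Definition weak_star_ball_filter s : set_system (Linfty mu) :=
  [set U | exists vs e, 0 < e /\ weak_star_ball s vs e `<=` U].

Lemma weak_star_ball_filter_filter s : Filter (weak_star_ball_filter s).
Proof.
split.
- by exists [::], 1; split.
- move=> U V [vs [e [e0 vsU]]] [ws [r [r0 wsV]]].
  exists (vs ++ ws), (Num.min e r); split; first by rewrite lt_min e0 r0.
  move=> s' s's; split.
  + apply: vsU => v vvs; have /s's : v \in vs ++ ws by rewrite mem_cat vvs.
    by rewrite lt_min => /andP[].
  + apply: wsV => v vws; have /s's : v \in vs ++ ws by rewrite mem_cat vws orbT.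
    by rewrite lt_min => /andP[].
- move=> U V UV [vs [e [e0 vsU]]]; exists vs, e; split => //.
  exact: subset_trans UV.
Qed.

(** This says that the filter generated by the balls around [s] converges to [s]; by the initial and
    product structure, balls for a single [v] suffice to check it. *)
Lemma nbhs_weak_star s (U : set (Linfty mu)) : nbhs (s : weak_star mu) U ->
  exists vs e, 0 < e /\ weak_star_ball s vs e `<=` U.
Proof.
have FG := weak_star_ball_filter_filter s.
apply: (@cvg_initial (Linfty mu) {ptws L1 mu -> R}
  (fun s v => dual_pairing s v) (weak_star_ball_filter s) s).
apply: (@cvg_ptws (L1 mu) R
  ((fun s v => dual_pairing s v) @ weak_star_ball_filter s)) => v.
apply/cvgrPdist_lt => e e0; exists [:: v], e; split=> // s' /(_ v).
by rewrite mem_head distrC; apply.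
Qed.

Lemma weak_star_continuous v :
  continuous (fun s : weak_star mu => dual_pairing (s : Linfty mu) v).
Proof.
move=> s; apply: (@continuous_comp (weak_star mu) {ptws L1 mu -> R} R
  (fun s v => dual_pairing (s : Linfty mu) v) (fun g => g v)).
  exact: (@initial_continuous (Linfty mu) {ptws L1 mu -> R}).
exact: (@proj_continuous (L1 mu) (fun=> R) v).
Qed.
End largest_norm.

(** * The subdifferential at 0 as a weak-* closed convex hull *)

Theorem theorem3p27 (d : measure_display) (T : measurableType d) (R : realType)
    (mu : {measure set T -> \bar R}) (K : R) :
  sigma_finite [set: T] mu -> 0 < K -> (K%:E < mu [set: T])%E ->
  subdifferential0 mu (largest_norm mu K) =
  weak_star_closed_convex_hull mu (signed_indicators mu K).
Proof.
move=> _ /ltW K0 _; apply/seteqP; split => s.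
  (* A hull point is needed in an arbitrary weak-* ball around [s]. The norm bounds the pairing on
     the hull, and the subgradient inequality makes signed indicators nearly reach the pairing of
     [s] with each [v]. *)
  move=> sK U /nbhs_weak_star[vs [e [e0 vsU]]].
  have [v|v r r0|x Cx xs] := @weak_approximation _ _ _ _
    (@dual_pairing_scalarl _ _ _ mu) (@dual_pairing_scalarr _ _ _ mu)
    (signed_indicators mu K) s _ _ vs e e0;
    last by exists x; split=> //; exact: vsU.
  - exists (fine (largest_norm mu K v)) => f Cf.
    rewrite -lee_fin (fineK (largest_norm_fin_num v K0)).
    exact: convex_hull_signed_indicators_le.
  - have : ((dual_pairing s v - r)%:E < largest_norm mu K v)%E.
      by apply: lt_le_trans (sK v); rewrite lte_fin ltrBlDr ltrDl.
    move=> /ereal_sup_gt[_ [A [mA muA] <-] rA].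
    have [f Sf fA] := signed_indicators_exists v mA muA.
    by exists f => //; rewrite -lte_fin fA.
(* The inequality holds on the hull; weak-* continuity of the pairing with [v] carries it to the
   closure up to an arbitrary [e]. *)
move=> sC v; apply/lee_addgt0Pr => e e0.
have /sC[c [Cc sc]] : nbhs (s : weak_star mu)
    [set c | `|dual_pairing s v - dual_pairing (c : Linfty mu) v| < e].
  by have /cvgrPdist_lt := @weak_star_continuous _ _ _ mu v s; apply.
rewrite -leeBlDr//; apply: le_trans (convex_hull_signed_indicators_le v K0 Cc).
rewrite -EFinB lee_fin lerBlDr -lerBlDl.
exact: le_trans (ler_norm _) (ltW sc).
Qed.
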